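(* Let $f$ satisfy $(\mathcal A)$, let $t_0>0$, $q>0$, $p\ge1$, $\gamma>1$. Let $x:[t_0,+\infty[\to\mathcal H$ be twice continuously differentiable and $\lambda:[t_0,+\infty[\to\,]0,+\infty[$ continuously differentiable, and let $\tau(t)=\frac{1}{q^q}\big(t_0+\int_{t_0}^t[\lambda(r)]^{1/q}dr\big)^q$, such that for all $t\ge t_0$: $$\ddot x(t)+\frac{(1+\gamma)\dot\tau(t)^2-\tau(t)\ddot\tau(t)}{\tau(t)\dot\tau(t)}\dot x(t)+\gamma\frac{\dot\tau(t)^2}{\tau(t)}\nabla f\Big(x(t)+\frac1\gamma\frac{\tau(t)}{\dot\tau(t)}\dot x(t)\Big)=0,$$ $$[\lambda(t)]^p|\dot\tau(t)|^{p-1}\Big\|\nabla f\Big(x(t)+\frac1\gamma\frac{\tau(t)}{\dot\tau(t)}\dot x(t)\Big)\Big\|^{p-1}=1 .$$ Then $f(x(t))-\inf_{\mathcal H}f=o\big(t^{-(1+q-\frac1p)}\big)$ as $t\to+\infty$, and $x(t)$ converges weakly as $t\to+\infty$ to an element of $S=\operatorname{argmin} f$.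
   Context: $\mathcal H$ is a real Hilbert space. Assumption $(\mathcal A)$: $f:\mathcal H\to\mathbb R$ is convex and continuously differentiable, $S=\operatorname{argmin}_{\mathcal H} f\neq\emptyset$, and $\nabla f$ is Lipschitz continuous on bounded subsets of $\mathcal H$. *)

(* Defs.v *)
From HB Require Import structures.
From mathcomp Require Import all_boot all_order all_algebra.
From mathcomp Require Import all_classical all_reals all_analysis.
Set Implicit Arguments. Unset Strict Implicit. Unset Printing Implicit Defensive.
Import Order.TTheory GRing.Theory Num.Theory.
Import numFieldNormedType.Exports.
Local Open Scope classical_set_scope.
Local Open Scope ring_scope.

(* A real Hilbert space: a complete normed space H whose norm comes from an
   inner product [inner] (symmetric, linear in the first argument,
   inner x x = |x|^2). *)
Record inner_product (R : realType) (H : normedModType R) := InnerProduct {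
  inner :> H -> H -> R;
  inner_sym : forall x y, inner x y = inner y x;
  inner_linD : forall x y z, inner (x + y) z = inner x z + inner y z;
  inner_linZ : forall (a : R) x y, inner (a *: x) y = a * inner x y;
  inner_norm : forall x, inner x x = `|x| ^+ 2
}.

Definition assumptionA (R : realType) (H : completeNormedModType R)
    (ip : inner_product H) (f : H -> R) (gf : H -> H) : Prop :=
  [/\ (forall x y (a : R), 0 <= a <= 1 ->
         f (a *: x + (1 - a) *: y) <= a * f x + (1 - a) * f y),
      (forall x, differentiable f x /\ forall h, 'd f x h = ip (gf x) h),
      continuous gf,
      (exists xs : H, forall y, f xs <= f y) &
      (forall B : set H, bounded_set B ->
         exists L : R, forall x y, B x -> B y ->
           `|gf x - gf y| <= L * `|x - y|)].

Definition argmin (R : realType) (H : normedModType R) (f : H -> R) : set H :=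
  [set xs | forall y, f xs <= f y].

Definition weak_cvg_pinfty (R : realType) (H : normedModType R)
    (ip : inner_product H) (x : R -> H) (z : H) : Prop :=
  forall h : H, (fun t => ip (x t) h) @ +oo --> ip z h.

Definition tau_of (R : realType) (t0 q : R) (lam : R -> R) (t : R) : R :=
  (q `^ q)^-1 *
  (t0 + \int[lebesgue_measure]_(r in `[t0, t]) (lam r `^ q^-1)) `^ q.

(* f = o(g) as t -> +oo; this is literally MathComp-Analysis' [littleo_def]
   (landau.v) for the filter +oo on R. *)
Definition littleo_pinfty (R : realType) (f g : R -> R) : Prop :=
  forall eps : R, 0 < eps -> \forall t \near +oo, `|f t| <= eps * `|g t|.

(* Main.v *)
Require Import Defs.
From HB Require Import structures.
From mathcomp Require Import all_boot all_order all_algebra.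
From mathcomp Require Import all_classical all_reals all_analysis.
From mathcomp Require Import ring lra.
Import Order.TTheory GRing.Theory Num.Theory.
Import numFieldNormedType.Exports.
Local Open Scope classical_set_scope.
Local Open Scope ring_scope.

(** The curve [y = x + (tau / (gamma tau')) x'] follows a time-rescaled steepest
    descent, [y' = - tau' grad f(y)], while [x' = gamma (tau' / tau) (y - x)] is
    an average of [y].  For a minimizer [z], both [|y - z|^2 / 2] and
    [tau (f(y) - min f) + |y - z|^2 / 2] decrease, the latter at rate at least
    [tau tau' |grad f(y)|^2]; this yields [f(y) - min f = o(1 / tau)], and
    averaging with [gamma > 1] transfers the bound to [x].

    With [theta = tau^(1/q)] and [mu = lambda^(1/q) = q theta'], the closed-loop
    law turns the dissipation rate into [theta mu^(- m)],
    [m = 1 + 2 q p / (p - 1)].  Its integrability forces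
    [theta >= c t^((m + 1) / (m - 1))], that is [tau >= c t^(1 + q - 1/p)].

    Weak convergence of [y] is Opial's argument.  Weak sequential compactness is
    replaced by points lying in every closed half-space that contains the tail
    of [y] along an unbounded set of times. *)

Section InnerProduct.
Set Implicit Arguments.
Unset Strict Implicit.
Variables (R : realType) (H : normedModType R) (ip : inner_product H).

Lemma innerDr a b c : ip a (b + c) = ip a b + ip a c.
Proof. by rewrite inner_sym inner_linD !(inner_sym ip a). Qed.

Lemma innerZr (k : R) a b : ip a (k *: b) = k * ip a b.
Proof. by rewrite inner_sym inner_linZ inner_sym. Qed.

Lemma innerNl a b : ip (- a) b = - ip a b.
Proof. by rewrite -scaleN1r inner_linZ mulN1r. Qed.

Lemma innerNr a b : ip a (- b) = - ip a b.
Proof. by rewrite inner_sym innerNl inner_sym. Qed.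

Lemma innerBl a b c : ip (a - b) c = ip a c - ip b c.
Proof. by rewrite inner_linD innerNl. Qed.

Lemma innerBr a b c : ip a (b - c) = ip a b - ip a c.
Proof. by rewrite innerDr innerNr. Qed.

Lemma inner_ge0 a : 0 <= ip a a.
Proof. by rewrite inner_norm exprn_ge0. Qed.

Lemma inner_eq0 a : ip a a = 0 -> a = 0.
Proof.
by rewrite inner_norm => /eqP; rewrite expf_eq0 normr_eq0 => /andP[_ /eqP].
Qed.

Lemma inner_polar a b : ip a b = 4^-1 * (`|a + b| ^+ 2 - `|a - b| ^+ 2).
Proof.
rewrite -!(inner_norm ip) innerBl !innerBr inner_linD !innerDr.
rewrite (inner_sym ip b a).
by field.
Qed.

(* Continuity of the inner product is inherited from that of the norm. *)
Lemma cvg_inner (T : Type) (F : set_system T) (FF : Filter F)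
    (u v : T -> H) a b :
  u @ F --> a -> v @ F --> b -> ip (u t) (v t) @[t --> F] --> ip a b.
Proof.
move=> ua vb; rewrite inner_polar.
under eq_fun do rewrite inner_polar.
apply: cvgM; first exact: cvg_cst.
have sqr (w : T -> H) c : w @ F --> c -> `|w t| ^+ 2 @[t --> F] --> `|c| ^+ 2.
  move=> wc; rewrite expr2; under eq_fun do rewrite expr2.
  by apply: cvgM; exact: cvg_norm.
apply: cvgB; apply: sqr; first exact: cvgD.
exact: cvgB.
Qed.

End InnerProduct.

Section Calculus.
Set Implicit Arguments.
Unset Strict Implicit.
Variable R : realType.

Lemma is_derive_cvg (V : normedModType R) (u : R -> V) (t : R) du :
  is_derive t 1 u du <-> h^-1 *: (u (h + t) - u t) @[h --> 0^'] --> du.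
Proof.
have E : (fun h : R => h^-1 *: ((u \o shift t) (h *: 1) - u t)) =
  (fun h : R => h^-1 *: (u (h + t) - u t)).
  by apply/funext => h /=; rewrite /GRing.scale /= mulr1.
split.
  move=> [du1 du2]; move: du1; rewrite /derivable E => c.
  by move: du2; rewrite /derive E => <-.
move=> c; split; first by rewrite /derivable E; apply/cvg_ex; exists du.
rewrite /derive E; exact: cvg_lim.
Qed.

Lemma is_derive_cvg_shift (V : normedModType R) (u : R -> V) (t : R) du :
  is_derive t 1 u du -> u (h + t) @[h --> 0^'] --> u t.
Proof.
move=> ud.
have /differentiable_continuous uc : differentiable u t.
  by apply/derivable1_diffP; exact: ex_derive.
apply: cvg_within_filter.
by rewrite (_ : (fun h => u (h + t)) = u \o shift t) // cvg_comp_shift add0r.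
Qed.

Lemma is_derive_scale (V : normedModType R) (k : R -> R) (u : R -> V)
    (t : R) dk du :
  is_derive t 1 k dk -> is_derive t 1 u du ->
  is_derive t 1 (fun s => k s *: u s) (dk *: u t + k t *: du).
Proof.
move=> kd ud; apply/is_derive_cvg.
have E : (fun h => h^-1 *: (k (h + t) *: u (h + t) - k t *: u t)) =
  (fun h => (h^-1 * (k (h + t) - k t)) *: u (h + t) +
            k t *: (h^-1 *: (u (h + t) - u t))).
  apply/funext => h; rewrite -scalerA scalerBl [k t *: (_ *: _)]scalerA.
  rewrite (mulrC (k t)) -[(h^-1 * k t) *: _]scalerA -scalerDr.
  by rewrite [k t *: (_ - _)]scalerBr addrA subrK.
rewrite E; apply: cvgD.
  apply: cvgZ; last exact: is_derive_cvg_shift ud.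
  exact/is_derive_cvg.
by apply: cvgZl_tmp; exact/is_derive_cvg.
Qed.

Lemma is_derive_inner (H : normedModType R) (ip : inner_product H)
    (u v : R -> H) (t : R) du dv :
  is_derive t 1 u du -> is_derive t 1 v dv ->
  is_derive t 1 (fun s => ip (u s) (v s)) (ip du (v t) + ip (u t) dv).
Proof.
move=> ud vd; apply/is_derive_cvg.
have E : (fun h => h^-1 *: (ip (u (h + t)) (v (h + t)) - ip (u t) (v t))) =
  (fun h => ip (h^-1 *: (u (h + t) - u t)) (v (h + t)) +
            ip (u t) (h^-1 *: (v (h + t) - v t))).
  apply/funext => h; rewrite /GRing.scale /= -/GRing.scale.
  by rewrite inner_linZ innerZr innerBl innerBr; ring.
rewrite E; apply: cvgD; apply: cvg_inner; try exact: cvg_cst.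
- exact/is_derive_cvg.
- exact: is_derive_cvg_shift vd.
- exact/is_derive_cvg.
Qed.

Lemma is_derive_add (V : normedModType R) (u v : R -> V) (t : R) du dv :
  is_derive t 1 u du -> is_derive t 1 v dv ->
  is_derive t 1 (fun s => u s + v s) (du + dv).
Proof. exact: is_deriveD. Qed.

Lemma is_derive_addl (V : normedModType R) (a : V) (u : R -> V) (t : R) du :
  is_derive t 1 u du -> is_derive t 1 (fun s => a + u s) du.
Proof.
move=> ud; rewrite -[X in is_derive _ _ _ X]add0r.
exact: is_derive_add (is_derive_cst a t 1) ud.
Qed.

Lemma is_derive_addr (V : normedModType R) (a : V) (u : R -> V) (t : R) du :
  is_derive t 1 u du -> is_derive t 1 (fun s => u s + a) du.
Proof.
by move=> ud; under eq_fun do rewrite addrC; exact: is_derive_addl.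
Qed.

Lemma is_derive_mul (g k : R -> R) (t : R) dg dk :
  is_derive t 1 g dg -> is_derive t 1 k dk ->
  is_derive t 1 (fun s => g s * k s) (dg * k t + g t * dk).
Proof. exact: is_derive_scale. Qed.

Lemma is_derive_mull (a : R) (g : R -> R) (t : R) dg :
  is_derive t 1 g dg -> is_derive t 1 (fun s => a * g s) (a * dg).
Proof. exact: is_deriveZ. Qed.

Lemma is_derive_powR (g : R -> R) (t dg a : R) :
  0 < g t -> is_derive t 1 g dg ->
  is_derive t 1 (fun s => g s `^ a) (a * g t `^ (a - 1) * dg).
Proof.
move=> g0 gd; apply: (@is_derive1_comp _ (fun s => s `^ a) g) => //.
exact: is_derive1_powR.
Qed.

Lemma nonincreasing_is_derive (g dg : R -> R) (a : R) :
  (forall t, a < t -> is_derive t 1 g (dg t)) ->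
  (forall t, a < t -> dg t <= 0) ->
  forall s t, a < s -> s <= t -> g t <= g s.
Proof.
move=> gd dg0 s t as_ st.
have [||c] := @MVT_segment R g dg s t st.
- by move=> z; rewrite in_itv /= => /andP[sz _]; apply: gd; exact: lt_trans sz.
- apply: derivable_within_continuous => z; rewrite in_itv /= => /andP[sz _].
  have az : a < z by exact: lt_le_trans sz.
  by apply: ex_derive; exact: gd.
rewrite in_itv /= => /andP[sc _] E.
rewrite -subr_le0 E mulr_le0_ge0 ?subr_ge0 //.
by apply: dg0; exact: lt_le_trans sc.
Qed.

Lemma nonincreasing_cvg_pinfty (g : R -> R) (a c : R) :
  (forall s t, a < s -> s <= t -> g t <= g s) ->
  (forall t, a < t -> c <= g t) ->
  exists l : R, g @ +oo --> l.
Proof.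
move=> gn gc; pose h t := - g (Num.max t (a + 1)).
have ha t : a < Num.max t (a + 1) by rewrite lt_max ltrDl ltr01 orbT.
have hn : nondecreasing_fun h.
  move=> s t st; rewrite /h lerN2; apply: gn => //.
  by rewrite ge_max !le_max st lexx /= orbT.
have hb : has_ubound (range h).
  by exists (- c) => _ [t _ <-]; rewrite /h lerN2; exact: gc.
exists (- sup (range h)).
have := nondecreasing_cvgr hn hb => /cvgN.
apply: cvg_trans; apply: near_eq_cvg; near=> t.
rewrite /h /= opprK; congr g; rewrite max_l //.
Unshelve. all: by end_near. Qed.

End Calculus.

Section ConvexGradient.
Set Implicit Arguments.
Unset Strict Implicit.
Variables (R : realType) (H : completeNormedModType R) (ip : inner_product H).
Variables (f : H -> R) (gf : H -> H).
Hypothesis fA : assumptionA ip f gf.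

Lemma is_derive_grad (u : R -> H) (t : R) du : is_derive t 1 u du ->
  is_derive t 1 (fun s => f (u s)) (ip (gf (u t)) du).
Proof.
case: fA => _ fgrad _ _ _ ud; have [fd fdE] := fgrad (u t).
have udiff : differentiable u t by apply/derivable1_diffP; exact: ex_derive.
have cdiff : differentiable (f \o u) t by exact: differentiable_comp.
split; first exact/derivable1_diffP.
rewrite (_ : (fun s => f (u s)) = f \o u) // deriveE // diff_comp //= fdE.
by rewrite -deriveE // derive_val.
Qed.

Lemma grad_convex_le a b : f a + ip (gf a) (b - a) <= f b.
Proof.
case: (fA) => fconv _ _ _ _.
pose u (s : R) := a + s *: (b - a).
have ud : is_derive (0 : R) 1 u (b - a).
  apply: is_derive_addl.
  rewrite -[X in is_derive _ _ _ X]scale1r -[X in is_derive _ _ _ X]addr0.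
  rewrite -[X in is_derive _ _ _ (_ + X)](scaler0 _ (0 : R)).
  exact: is_derive_scale (is_derive_id _ _) (is_derive_cst _ _ _).
have u0 : u 0 = a by rewrite /u scale0r addr0.
have /is_derive_cvg/cvg_dnbhs_at_right := is_derive_grad ud.
rewrite u0 => c; rewrite -lerBrDl.
apply: (ler_cvg_to c (@cvg_cst _ (f b - f a) _ _ _)).
near=> h.
have h0 : 0 < h by near: h; exact: nbhs_right_gt.
have h1 : h <= 1 by near: h; exact: nbhs_right_le.
rewrite addr0 /GRing.scale /= ler_pdivrMl //.
have -> : u h = h *: b + (1 - h) *: a.
  by rewrite /u scalerBr scalerBl scale1r addrCA addrA.
have := fconv b a h; rewrite (ltW h0) h1 => /(_ isT); lra.
Unshelve. all: by end_near. Qed.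

End ConvexGradient.

Section GradientFlow.
Set Implicit Arguments.
Unset Strict Implicit.
Variables (R : realType) (H : completeNormedModType R) (ip : inner_product H).
Variables (f : H -> R) (gf : H -> H).
Hypothesis fA : assumptionA ip f gf.
Variables (t0 : R) (tau dtau : R -> R) (y : R -> H).
Hypothesis tau_gt0 : forall t, t0 < t -> 0 < tau t.
Hypothesis dtau_gt0 : forall t, t0 < t -> 0 < dtau t.
Hypothesis tauD : forall t, t0 < t -> is_derive t 1 tau (dtau t).
Hypothesis yD : forall t, t0 < t -> is_derive t 1 y (- dtau t *: gf (y t)).

Definition flow_dist z t := 2^-1 * ip (y t - z) (y t - z).
Definition flow_energy z t := tau t * (f (y t) - f z) + flow_dist z t.

Lemma flow_dist_ge0 z t : 0 <= flow_dist z t.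
Proof. by rewrite mulr_ge0 ?inner_ge0 // invr_ge0. Qed.

Lemma is_derive_flow_dist z t : t0 < t ->
  is_derive t 1 (flow_dist z) (- dtau t * ip (gf (y t)) (y t - z)).
Proof.
move=> t0t; have ? := yD t0t.
have dz : is_derive t 1 (fun s => y s - z) (- dtau t *: gf (y t)).
  exact: is_derive_addr.
have := is_derive_inner ip dz dz => D.
apply: is_derive_eq (is_derive_mull 2^-1 D) _.
rewrite /GRing.scale /= !inner_linZ innerZr (inner_sym ip (y t - z)).
by field.
Qed.

Lemma is_derive_flow_energy z t : t0 < t ->
  is_derive t 1 (flow_energy z)
    (dtau t * (f (y t) - f z - ip (gf (y t)) (y t - z))
     - tau t * dtau t * `|gf (y t)| ^+ 2).
Proof.
move=> t0t; have yd := yD t0t; have td := tauD t0t.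
have fd := is_derive_grad fA yd.
have dd := is_derive_flow_dist z t0t.
apply: is_derive_eq
  (is_derive_add (is_derive_mul td (is_derive_addr (- f z) fd)) dd) _.
rewrite /GRing.scale /= innerZr inner_norm; ring.
Qed.

Lemma flow_inner_ge z t : f (y t) - f z <= ip (gf (y t)) (y t - z).
Proof.
by have := grad_convex_le fA (y t) z; rewrite -opprB innerNr; lra.
Qed.

Lemma flow_dist_nincr z : argmin f z -> forall s t, t0 < s -> s <= t ->
  flow_dist z t <= flow_dist z s.
Proof.
move=> zS; apply: nonincreasing_is_derive => t t0t.
  exact: is_derive_flow_dist.
rewrite /= mulNr oppr_le0 mulr_ge0 ?(ltW (dtau_gt0 t0t)) //.
by apply: le_trans (flow_inner_ge z t); rewrite subr_ge0; exact: zS.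
Qed.

Lemma flow_energy_derive_le z t : argmin f z -> t0 < t ->
  dtau t * (f (y t) - f z - ip (gf (y t)) (y t - z))
     - tau t * dtau t * `|gf (y t)| ^+ 2
  <= - (tau t * dtau t * `|gf (y t)| ^+ 2).
Proof.
move=> zS t0t; rewrite gerDr mulr_ge0_le0 ?(ltW (dtau_gt0 t0t)) //.
by rewrite subr_le0; exact: flow_inner_ge.
Qed.

Lemma flow_energy_nincr z : argmin f z -> forall s t, t0 < s -> s <= t ->
  flow_energy z t <= flow_energy z s.
Proof.
move=> zS; apply: nonincreasing_is_derive => t t0t.
  exact: is_derive_flow_energy.
apply: le_trans (flow_energy_derive_le zS t0t) _.
by rewrite oppr_le0 !mulr_ge0 ?exprn_ge0 // ltW // (dtau_gt0, tau_gt0).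
Qed.

Lemma flow_gap_ge0 z t : argmin f z -> t0 < t -> 0 <= tau t * (f (y t) - f z).
Proof.
by move=> zS t0t; rewrite mulr_ge0 ?(ltW (tau_gt0 t0t)) // subr_ge0; exact: zS.
Qed.

Lemma flow_energy_ge0 z t : argmin f z -> t0 < t -> 0 <= flow_energy z t.
Proof. by move=> zS t0t; rewrite addr_ge0 ?flow_dist_ge0 ?flow_gap_ge0. Qed.

Lemma cvg_flow_dist z : argmin f z -> exists l : R, flow_dist z @ +oo --> l.
Proof.
move=> zS; apply: (@nonincreasing_cvg_pinfty _ _ t0 0).
  exact: flow_dist_nincr.
by move=> t _; exact: flow_dist_ge0.
Qed.

Hypothesis tau_pinfty : tau @ +oo --> +oo.

(* If [tau * (f y - min f)] had a limit [2 c > 0], then [flow_dist z + c ln tau]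
   would eventually be nonincreasing, hence [ln tau] bounded. *)
Lemma flow_gap_cvg0 z : argmin f z ->
  tau t * (f (y t) - f z) @[t --> +oo] --> 0.
Proof.
move=> zS; have [ld cd] := cvg_flow_dist zS.
have [le ce] : exists l : R, flow_energy z @ +oo --> l.
  apply: (@nonincreasing_cvg_pinfty _ _ t0 0); first exact: flow_energy_nincr.
  by move=> t; exact: flow_energy_ge0.
have cg : tau t * (f (y t) - f z) @[t --> +oo] --> le - ld.
  have -> : (fun t => tau t * (f (y t) - f z)) =
            (fun t => flow_energy z t - flow_dist z t).
    by apply/funext => t; rewrite addrK.
  exact: cvgB.
suff l0 : le - ld <= 0.
  have <- // : le - ld = 0; apply/eqP; rewrite eq_le l0 /=.
  apply: (ler_cvg_to (@cvg_cst _ 0 _ _ _) cg); near=> t.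
  by apply: flow_gap_ge0 => //; near: t; exact: nbhs_pinfty_gt (num_real _).
rewrite leNgt; apply/negP => l_gt0.
pose c := (le - ld) / 2.
have c0 : 0 < c by rewrite divr_gt0.
have cl : c < le - ld by rewrite /c; lra.
have [T [_ Tc]] := cvgr_ge _ cg _ cl.
pose a := Num.max T t0.
have aT t : a < t -> T < t by rewrite gt_max => /andP[].
have at0 t : a < t -> t0 < t by rewrite gt_max => /andP[].
have nincr : forall s t, a < s -> s <= t ->
    flow_dist z t + c * ln (tau t) <= flow_dist z s + c * ln (tau s).
  pose dg t := - dtau t * ip (gf (y t)) (y t - z) + c * ((tau t)^-1 * dtau t).
  apply: (@nonincreasing_is_derive _ _ dg) => t lt_at.
    apply: is_derive_add; first exact: is_derive_flow_dist (at0 _ lt_at).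
    apply: is_derive_mull; apply: is_derive1_comp (tauD (at0 _ lt_at)).
    exact: is_derive1_ln (tau_gt0 (at0 _ lt_at)).
  rewrite /dg; have := Tc _ (aT _ lt_at) => /= cle.
  have tt0 := tau_gt0 (at0 _ lt_at).
  have dt0 := dtau_gt0 (at0 _ lt_at).
  have : c * (tau t)^-1 <= ip (gf (y t)) (y t - z).
    apply: le_trans (flow_inner_ge z t).
    by rewrite ler_pdivrMr // mulrC.
  move=> h; have := ler_wpM2r (ltW dt0) h; rewrite mulrA; lra.
have a1 : a < a + 1 by rewrite ltrDl.
pose K := flow_dist z (a + 1) + c * ln (tau (a + 1)).
have [T' [_ T'c]] : \forall t \near +oo, expR (K / c) < tau t.
  by apply: (cvgry_gt tau_pinfty).
pose t := Num.max (a + 1) (T' + 1).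
have ta : a + 1 <= t by rewrite le_max lexx.
have tT' : T' < t by rewrite lt_max ltrDl ltr01 orbT.
have := nincr _ _ a1 ta; rewrite -/K; apply/negP; rewrite -ltNge.
have tt0 : 0 < tau t by apply/tau_gt0/at0/(lt_le_trans a1).
have := T'c _ tT'; rewrite -[X in _ < X]lnK ?posrE // ltr_expR.
rewrite ltr_pdivrMr // mulrC => h.
by apply: (lt_le_trans h); rewrite lerDr flow_dist_ge0.
Unshelve. all: by end_near. Qed.

End GradientFlow.

Section Averaging.
Set Implicit Arguments.
Unset Strict Implicit.
Variables (R : realType) (t0 : R) (tau dtau : R -> R).
Hypothesis tau_gt0 : forall t, t0 < t -> 0 < tau t.
Hypothesis dtau_gt0 : forall t, t0 < t -> 0 < dtau t.
Hypothesis tauD : forall t, t0 < t -> is_derive t 1 tau (dtau t).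
Hypothesis tau_pinfty : tau @ +oo --> +oo.

Lemma near_le_powR (a A : R) : 0 < a -> \forall t \near +oo, A <= tau t `^ a.
Proof.
move=> a0; near=> t.
have h : (`|A| + 1) `^ a^-1 < tau t.
  by near: t; exact: cvgry_gt.
have A0 : 0 <= `|A| + 1 by rewrite addr_ge0.
apply: (@le_trans _ _ (((`|A| + 1) `^ a^-1) `^ a)).
  rewrite -powRrM mulVf ?gt_eqF // powRr1 //.
  by apply: (le_trans (ler_norm _)); rewrite lerDl.
apply: ge0_ler_powR; rewrite ?nnegrE ?ltW ?powR_gt0 //.
by apply: le_lt_trans h; exact: powR_ge0.
Unshelve. all: by end_near. Qed.

(* [tau ^ gamma * W - eps * gamma / (gamma - b) * tau ^ (gamma - b)] is
   eventually nonincreasing. *)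
Lemma averaged_le (gamma b eps : R) (W dW v : R -> R) :
  0 <= b -> b < gamma -> 0 < eps ->
  (forall t, t0 < t -> is_derive t 1 W (dW t)) ->
  (forall t, t0 < t -> dW t <= gamma * (dtau t / tau t) * (v t - W t)) ->
  (\forall t \near +oo, v t <= eps * tau t `^ (- b)) ->
  \forall t \near +oo,
    W t <= (eps * gamma / (gamma - b) + eps) * tau t `^ (- b).
Proof.
move=> b0 bg e0 WD dWle [T [_ Tv]].
have gb0 : 0 < gamma - b by rewrite subr_gt0.
have g0 : 0 < gamma by exact: le_lt_trans bg.
pose a := Num.max T t0; pose K := eps * gamma / (gamma - b).
have aT t : a < t -> T < t by rewrite gt_max => /andP[].
have at0 t : a < t -> t0 < t by rewrite gt_max => /andP[].
pose P t := tau t `^ (gamma - b); pose Q t := tau t `^ b.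
have PQ t : a < t -> tau t `^ gamma = P t * Q t.
  move=> /at0/tau_gt0 tt; rewrite /P /Q -powRD ?subrK //.
  by rewrite (gt_eqF tt) /= implybT.
have pB1 t c : a < t -> tau t `^ (c - 1) = tau t `^ c / tau t.
  move=> /at0/tau_gt0 tt; rewrite powRB ?powRr1 ?(ltW tt) //.
  by rewrite (gt_eqF tt) /= implybT.
have P0 t : a < t -> 0 < P t by move=> /at0/tau_gt0; exact: powR_gt0.
have Q0 t : a < t -> 0 < Q t by move=> /at0/tau_gt0; exact: powR_gt0.
pose G t := tau t `^ gamma * W t - K * tau t `^ (gamma - b).
have nincr : forall s t, a < s -> s <= t -> G t <= G s.
  pose dG t :=
    (gamma * tau t `^ (gamma - 1) * dtau t * W t + tau t `^ gamma * dW t)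
     + (- K) * ((gamma - b) * tau t `^ (gamma - b - 1) * dtau t).
  apply: (@nonincreasing_is_derive _ _ dG) => t lat; have t0t := at0 _ lat.
    rewrite /G; under eq_fun do rewrite -mulNr.
    apply: is_derive_add.
      apply: is_derive_mul (WD _ t0t).
      exact: is_derive_powR (tau_gt0 t0t) (tauD t0t).
    by apply: is_derive_mull; exact: is_derive_powR (tau_gt0 t0t) (tauD t0t).
  rewrite /dG !pB1 // PQ // -/(P t).
  have tt := tau_gt0 t0t; have dt := dtau_gt0 t0t.
  have := ler_wpM2l (ltW (mulr_gt0 (P0 _ lat) (Q0 _ lat))) (dWle _ t0t) => h1.
  have h2 : 0 <= gamma * P t * (dtau t / tau t) * (eps - Q t * v t).
    apply: mulr_ge0; first by rewrite ltW // mulr_gt0 ?divr_gt0 ?mulr_gt0 ?P0.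
    have := Tv _ (aT _ lat).
    by rewrite subr_ge0 powRN -/(Q t) ler_pdivlMr ?Q0 // mulrC.
  have h3 : K * (gamma - b) = eps * gamma by rewrite /K divfK // gt_eqF.
  have h4 : K * ((gamma - b) * (P t / tau t) * dtau t) =
     eps * gamma * (P t * (dtau t / tau t)).
    rewrite -h3; ring.
  rewrite mulNr h4; lra.
have a1 : a < a + 1 by rewrite ltrDl.
near=> t.
have ta : a + 1 <= t by near: t; exact: nbhs_pinfty_ge (num_real _).
have lat : a < t by exact: lt_le_trans ta.
have GP : G (a + 1) / eps <= P t by near: t; exact: near_le_powR.
have := nincr _ _ a1 ta; rewrite {1}/G PQ // -/(P t).
rewrite ler_pdivrMr // in GP.
rewrite powRN -/(Q t) ler_pdivlMr ?Q0 // -/K => h.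
rewrite -(ler_pM2l (P0 _ lat)); lra.
Unshelve. all: by end_near. Qed.

End Averaging.

Section WeakConvergence.
Set Implicit Arguments.
Unset Strict Implicit.
Variables (R : realType) (H : completeNormedModType R) (ip : inner_product H).
Variable y : R -> H.

(* [w] lies in every closed half-space that eventually contains [y t] for
   [t] in [A]: it plays the role of a weak cluster point of [y] along [A]. *)
Definition weak_cluster (A : set R) (w : H) := forall T h c,
  (forall t, A t -> T < t -> ip (y t) h <= c) -> ip w h <= c.

(* Almost minimal-norm elements of the decreasing convex sets [C n] form a
   Cauchy sequence, by the parallelogram law. *)
Lemma weak_cluster_exists (A : set R) (M : R) :
  (forall T, exists2 t, T < t & A t) ->
  (forall t, A t -> ip (y t) (y t) <= M) ->
  exists w, weak_cluster A w.
Proof.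
move=> Aub AM.
pose C (n : nat) : set H := [set w | forall h c,
  (forall t, A t -> n%:R < t -> ip (y t) h <= c) -> ip w h <= c].
have CW m n : (m <= n)%N -> C n `<=` C m.
  move=> mn w Cw h c hc; apply: Cw => t At nt; apply: hc => //.
  by apply: le_lt_trans nt; rewrite ler_nat.
have Cmid n a b : C n a -> C n b -> C n (2^-1 *: (a + b)).
  move=> Ca Cb h c hc; rewrite inner_linZ inner_linD.
  have := Ca _ _ hc; have := Cb _ _ hc; lra.
pose N n := [set ip w w | w in C n].
have Nlb n : has_lbound (N n) by exists 0 => _ [w _ <-]; exact: inner_ge0.
have NM n : exists2 r, N n r & r <= M.
  have [t nt At] := Aub n%:R; exists (ip (y t) (y t)); last exact: AM.
  by exists (y t) => // h c; apply.
have Ninf n : has_inf (N n).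
  by split => //; have [r Nr _] := NM n; exists r.
pose d n := inf (N n).
have dM n : d n <= M.
  by have [r Nr rM] := NM n; apply: le_trans rM; exact: ge_inf.
have /choice[c cP] : forall n, exists w, C n w /\ ip w w < d n + n.+1%:R^-1.
  move=> n; have n0 : (0 : R) < n.+1%:R^-1 by rewrite invr_gt0 ltr0n.
  by have [_ [w Cw <-] h] := inf_adherent n0 (Ninf n); exists w.
pose D := sup (range d).
have Dsup : has_sup (range d).
  by split; [exists (d 0%N), 0%N | exists M => _ [n _ <-]].
have dD n : d n <= D by apply: ub_le_sup; [exact: Dsup.2|exists n].
have cC : cvg (c @ \oo).
  apply/cauchy_cvgP/cauchy_exP => e e0.
  pose r := e ^+ 2 / 16.
  have r0 : 0 < r by rewrite divr_gt0 // exprn_gt0.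
  have [_ [N0 _ <-] hN0] := sup_adherent r0 Dsup.
  pose N1 := (N0 + Num.truncn r^-1)%N.
  exists (c N1); exists N1 => // n /= Nn.
  have small m : (N1 <= m)%N -> (m.+1%:R : R)^-1 <= r.
    move=> Nm; rewrite -[leRHS]invrK lef_pV2 ?posrE ?invr_gt0 ?ltr0n //.
    apply: le_trans (ltW (truncnS_gt _)) _; rewrite ler_nat ltnS.
    by apply: leq_trans Nm; rewrite leq_addl.
  have dN1 : D - r < d N1.
    apply: (lt_le_trans hN0); apply: lb_le_inf => [|_ [w Cw <-]].
      by have [_] := Ninf N1; case: (Ninf N1).
    apply: ge_inf => //; exists w => //; apply: CW Cw; exact: leq_addr.
  have [C1 h1] := cP N1; have [Cn hn] := cP n.
  have hmid : d N1 <= ip (2^-1 *: (c N1 + c n)) (2^-1 *: (c N1 + c n)).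
    apply: ge_inf => //; exists (2^-1 *: (c N1 + c n)) => //.
    by apply: Cmid => //; exact: CW Cn.
  have s1 := small _ (leqnn _); have sn := small _ Nn.
  have A1 : ip (c N1) (c N1) < D + r by exact: lt_le_trans h1 (lerD (dD _) s1).
  have An : ip (c n) (c n) < D + r by exact: lt_le_trans hn (lerD (dD _) sn).
  have : ip (c N1 - c n) (c N1 - c n) < 16 * r.
    move: hmid dN1 A1 An r0; rewrite inner_linZ innerZr inner_linD innerBl.
    rewrite !innerDr !innerNr (inner_sym ip (c n) (c N1)).
    move: (ip _ _) (ip _ _) (ip _ _) (D) (r) (d N1) => a1 a2 a3 D' r' d1.
    lra.
  have -> : 16 * r = e ^+ 2 by rewrite /r; field.
  rewrite inner_norm -ball_normE /=.
  by rewrite ltr_pXn2r ?nnegrE ?normr_ge0 ?(ltW e0).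
exists (lim (c @ \oo)) => T h k hk.
have cl : ip (c n) h @[n --> \oo] --> ip (lim (c @ \oo)) h.
  by apply: cvg_inner; [exact: cC|exact: cvg_cst].
apply: (ler_cvg_to cl (@cvg_cst _ k _ _ _)).
exists (Num.truncn `|T|).+1 => // n /= Tn.
have [Cn _] := cP n; apply: Cn => t At nt; apply: hk => //.
apply: le_lt_trans nt; apply: (le_trans (ler_norm _)).
by apply: le_trans (ltW (truncnS_gt _)) _; rewrite ler_nat.
Qed.

Variable S : set H.
Hypothesis ySl : forall w w', S w -> S w' ->
  exists l : R, ip (y t) (w - w') @[t --> +oo] --> l.

Lemma weak_cluster_inner A w h (l : R) : weak_cluster A w ->
  ip (y t) h @[t --> +oo] --> l -> ip w h = l.
Proof.
have aux g k : weak_cluster A w -> ip (y t) g @[t --> +oo] --> k -> ip w g <= k.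
  move=> Aw yl; apply/ler_addgt0Pr => e e0.
  have [T [_ hT]] := cvgr_le _ yl _ (ltr_pwDr e0 (lexx k)).
  by apply: (Aw T) => t _; exact: hT.
move=> Aw yl; apply/eqP; rewrite eq_le aux //= -lerN2 -innerNr.
by apply: aux => //; under eq_fun do rewrite innerNr; exact: cvgN.
Qed.

Lemma weak_cluster_unique A B w w' : S w -> S w' ->
  weak_cluster A w -> weak_cluster B w' -> w = w'.
Proof.
move=> Sw Sw' Aw Bw'; have [l yl] := ySl Sw Sw'.
apply/eqP; rewrite -subr_eq0; apply/eqP; apply: (@inner_eq0 _ _ ip).
by rewrite innerBl (weak_cluster_inner Aw yl) (weak_cluster_inner Bw' yl) subrr.
Qed.

Lemma opial (t1 M : R) :
  (forall t, t1 < t -> ip (y t) (y t) <= M) ->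
  (forall A w, weak_cluster A w -> S w) ->
  exists2 z, S z & weak_cvg_pinfty ip y z.
Proof.
move=> yM clS.
have [z zc] : exists w, weak_cluster [set t | t1 < t] w.
  apply: weak_cluster_exists yM => T; exists (Num.max T t1 + 1).
    by rewrite (@le_lt_trans _ _ (Num.max T t1)) ?le_max ?lexx // ltrDl.
  by rewrite /= (@le_lt_trans _ _ (Num.max T t1)) ?le_max ?lexx ?orbT // ltrDl.
exists z; first exact: clS zc.
have half h (e : R) : 0 < e -> \forall t \near +oo, ip (y t) h - ip z h <= e.
  move=> e0; apply: contrapT => nnear.
  pose A := [set t | t1 < t /\ e < ip (y t) h - ip z h].
  have [w wc] : exists w, weak_cluster A w.
    apply: (@weak_cluster_exists A M) => [T|t [tt1 _]]; last exact: yM.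
    apply: contrapT => nex; apply: nnear.
    exists (Num.max T t1); split; first exact: num_real.
    move=> t; rewrite gt_max => /andP[Tt t1t]; rewrite leNgt; apply/negP => et.
    by apply: nex; exists t.
  have wz : w = z.
    exact: (weak_cluster_unique (clS _ _ wc) (clS _ _ zc) wc zc).
  have : ip w (- h) <= - (ip z h + e).
    apply: (wc t1) => t [_ et] _; rewrite innerNr lerN2; lra.
  by rewrite wz innerNr lerN2; lra.
move=> h; apply/cvgrPdist_le => e e0; near=> t.
rewrite ler_norml; apply/andP; split.
  by rewrite lerNl opprB; near: t; exact: half.
have : ip (y t) (- h) - ip z (- h) <= e by near: t; exact: half.
by rewrite !innerNr opprK addrC.
Unshelve. all: by end_near. Qed.

End WeakConvergence.

Section Growth.
Set Implicit Arguments.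
Unset Strict Implicit.
Variables (R : realType) (t0 q : R) (theta mu : R -> R).
Hypothesis t0_gt0 : 0 < t0.
Hypothesis q_gt0 : 0 < q.
Hypothesis theta_gt0 : forall t, t0 < t -> 0 < theta t.
Hypothesis mu_gt0 : forall t, t0 < t -> 0 < mu t.
Hypothesis thetaD : forall t, t0 < t -> is_derive t 1 theta (mu t / q).

(* The summands are [c^(- m)] and [c] for [c = e^-1 a^(- 1/m) b], so one of them
   is at least [1]. *)
Lemma one_le_split (m e a b : R) : 0 < m -> 0 < e -> 0 < a -> 0 < b ->
  1 <= e `^ m * (a * b `^ (- m)) + e^-1 * (a `^ (- m^-1) * b).
Proof.
move=> m0 e0 a0 b0; set c := e^-1 * (a `^ (- m^-1) * b).
have aN0 : 0 < a `^ (- m^-1) by exact: powR_gt0.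
have c0 : 0 < c by rewrite !mulr_gt0 ?invr_gt0.
have -> : e `^ m * (a * b `^ (- m)) = c `^ (- m).
  rewrite /c !powRM ?mulr_ge0 ?invr_ge0 ?ltW // -powRrM mulrNN mulVf ?gt_eqF //.
  by rewrite powRr1 ?ltW // -powR_inv1 ?ltW // -powRrM mulrNN mul1r.
have [c1|c1] := leP 1 c; first by rewrite ler_wpDl ?powR_ge0.
rewrite ler_wpDr ?(ltW c0) // powRN invf_ge1 ?powR_gt0 //.
rewrite -[leRHS](congr1 (@^~ m) (@powR1 R)).
by apply: ge0_ler_powR; rewrite ?nnegrE ltW.
Qed.

(* For every [e > 0], [t + e^m E - e^-1 K theta^k] is nonincreasing; the bound
   follows by taking [e] proportional to [t^(1/m)]. *)
Lemma theta_growth (m : R) (E dE : R -> R) : 1 < m ->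
  (forall t, t0 < t -> 0 <= E t) ->
  (forall t, t0 < t -> is_derive t 1 E (dE t)) ->
  (forall t, t0 < t -> dE t <= - (theta t * mu t `^ (- m))) ->
  exists2 c : R, 0 < c &
    \forall t \near +oo, c * t `^ ((m + 1) / (m - 1)) <= theta t.
Proof.
move=> m1 E0 ED dEle.
have m0 : 0 < m by lra.
have mN0 : m != 0 by rewrite gt_eqF.
pose k : R := 1 - m^-1.
have k0 : 0 < k by rewrite subr_gt0 invf_lt1.
pose K := q / k; have K0 : 0 < K by exact: divr_gt0.
pose t1 := t0 + 1; have t01 : t0 < t1 by rewrite ltrDl.
have main (e t : R) : 0 < e -> t1 <= t ->
    t <= t1 + e `^ m * E t1 + e^-1 * (K * theta t `^ k).
  move=> e0 t1t.
  pose Phi s := (s + e `^ m * E s) + (- (e^-1 * K)) * theta s `^ k.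
  pose dPhi s := (1 + e `^ m * dE s) +
     (- (e^-1 * K)) * (k * theta s `^ (k - 1) * (mu s / q)).
  have : Phi t <= Phi t1.
    apply: (@nonincreasing_is_derive _ Phi dPhi t0) => // s t0s.
      apply: is_derive_add.
        by apply: is_derive_add; apply: is_derive_mull; exact: ED.
      apply: is_derive_mull.
      exact: is_derive_powR (theta_gt0 t0s) (thetaD t0s).
    have h1 := one_le_split m0 e0 (theta_gt0 t0s) (mu_gt0 t0s).
    have h2 := ler_wpM2l (powR_ge0 e m) (dEle _ t0s).
    have h3 : - (e^-1 * K) * (k * theta s `^ (k - 1) * (mu s / q)) =
       - (e^-1 * (theta s `^ (- m^-1) * mu s)).
      have -> : k - 1 = - m^-1 by rewrite /k; ring.
      by rewrite /K; field; rewrite !gt_eqF.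
    rewrite /dPhi h3; lra.
  rewrite /Phi.
  have h1 : 0 <= e `^ m * E t.
    by rewrite mulr_ge0 ?powR_ge0 // E0 // (lt_le_trans t01).
  have h2 : 0 <= e^-1 * K * theta t1 `^ k.
    by rewrite !mulr_ge0 ?powR_ge0 ?invr_ge0 ?ltW.
  lra.
pose E1 := 4 * (E t1 + 1).
have E10 : 0 < E1 by have := E0 _ t01; rewrite /E1; lra.
pose c0 := (E1^-1 `^ m^-1) / (2 * K).
have c00 : 0 < c0.
  by apply: divr_gt0; [apply: powR_gt0; rewrite invr_gt0|exact: mulr_gt0].
exists (c0 `^ k^-1); first exact: powR_gt0.
near=> t.
have t1t : t1 <= t by near: t; exact: nbhs_pinfty_ge (num_real _).
have t14 : 4 * t1 <= t by near: t; exact: nbhs_pinfty_ge (num_real _).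
have tt0 : t0 < t by exact: lt_le_trans t1t.
have t_gt0 : 0 < t by exact: lt_trans tt0.
pose e := (t / E1) `^ m^-1.
have e0 : 0 < e by rewrite powR_gt0 // divr_gt0.
have em : e `^ m = t / E1.
  by rewrite /e -powRrM mulVf // powRr1 // ltW // divr_gt0.
have hE : e `^ m * E t1 <= t / 4.
  have e1 : E t1 = E1 / 4 - 1 by rewrite /E1; field.
  have : 0 <= t / E1 by rewrite ltW // divr_gt0.
  have : t / E1 * E1 = t by rewrite divfK // gt_eqF.
  rewrite em e1; lra.
have hk : c0 * t `^ (1 + m^-1) <= theta t `^ k.
  have := main _ _ e0 t1t => hm.
  have h2 : t / 2 <= e^-1 * (K * theta t `^ k) by lra.
  have -> : c0 * t `^ (1 + m^-1) = e * (t / 2) / K.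
    rewrite /c0 /e powRD; last by rewrite (gt_eqF t_gt0) implybT.
    rewrite powRr1 ?(ltW t_gt0) // powRM ?(ltW t_gt0) ?invr_ge0 ?(ltW E10) //.
    by field; rewrite gt_eqF.
  by rewrite ler_pdivrMr // -ler_pdivlMl // [_ * K]mulrC.
have := @ge0_ler_powR _ k^-1 _ _ _ _ _ hk.
rewrite invr_ge0 ltW // => /(_ isT); rewrite !nnegrE !powR_ge0.
rewrite mulr_ge0 ?powR_ge0 ?(ltW c00) // => /(_ isT isT).
rewrite powRM ?powR_ge0 ?(ltW c00) // -!powRrM mulfV ?gt_eqF //.
rewrite powRr1 ?(ltW (theta_gt0 tt0)) //.
have -> // : (1 + m^-1) / k = (m + 1) / (m - 1).
rewrite /k; field; rewrite mN0 /= subr_eq0 gt_eqF //.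
Unshelve. all: by end_near. Qed.

Lemma theta_growth1 : (forall t, t0 < t -> mu t = 1) ->
  exists2 c : R, 0 < c & \forall t \near +oo, c * t <= theta t.
Proof.
move=> mu1; exists (q^-1 / 2); first by rewrite !mulr_gt0 ?invr_gt0.
pose t1 := t0 + 1; have t01 : t0 < t1 by rewrite ltrDl.
near=> t.
have t1t : t1 <= t by near: t; exact: nbhs_pinfty_ge (num_real _).
have t12 : 2 * t1 <= t by near: t; exact: nbhs_pinfty_ge (num_real _).
pose g s := q^-1 * s + (-1) * theta s.
pose dg s := q^-1 * 1 + (-1) * (mu s / q).
have : g t <= g t1.
  apply: (@nonincreasing_is_derive _ g dg t0) => // s t0s.
    by apply: is_derive_add; apply: is_derive_mull; exact: thetaD.
  by rewrite /dg mu1 // mulr1 mul1r mulN1r subrr.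
have h1 := theta_gt0 t01.
have h2 : q^-1 * (2 * t1) <= q^-1 * t by rewrite ler_wpM2l // invr_ge0 ltW.
rewrite /g; lra.
Unshelve. all: by end_near. Qed.

End Growth.

Section Tau.
Set Implicit Arguments.
Unset Strict Implicit.
Variables (R : realType) (t0 q : R) (lam : R -> R).
Hypothesis t0_gt0 : 0 < t0.
Hypothesis q_gt0 : 0 < q.
Hypothesis lam_gt0 : forall t, t0 <= t -> 0 < lam t.
Hypothesis lam_cont : {within `[t0, +oo[, continuous lam}.
Hypothesis lamD : forall t, t0 < t -> derivable lam t 1.

Definition theta_of t :=
  q^-1 * (t0 + \int[lebesgue_measure]_(r in `[t0, t]) (lam r `^ q^-1)).

Definition mu_of t := lam t `^ q^-1.

Lemma theta_of_gt0 t : 0 < theta_of t.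
Proof.
rewrite mulr_gt0 ?invr_gt0 // ltr_wpDr //.
by apply: Rintegral_ge0 => r _; exact: powR_ge0.
Qed.

Lemma mu_of_gt0 t : t0 < t -> 0 < mu_of t.
Proof. by move=> t0t; rewrite powR_gt0 // lam_gt0 // ltW. Qed.

Lemma tau_ofE : tau_of t0 q lam = fun t => theta_of t `^ q.
Proof.
apply/funext => t; rewrite /tau_of /theta_of powRM ?invr_ge0 ?(ltW q_gt0) //.
  by congr (_ * _); rewrite -(powR_inv1 (ltW q_gt0)) -powRrM mulN1r powRN.
rewrite addr_ge0 ?(ltW t0_gt0) //.
by apply: Rintegral_ge0 => r _; exact: powR_ge0.
Qed.

Lemma powR_continuous_gt0 (a s : R) : 0 < s ->
  {for s, continuous (fun s => s `^ a)}.
Proof.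
move=> s0; apply: differentiable_continuous; apply/derivable1_diffP.
by apply: ex_derive; exact: is_derive1_powR.
Qed.

Lemma is_derive_theta t : t0 < t -> is_derive t 1 theta_of (mu_of t / q).
Proof.
move=> t0t.
have ci : (@lebesgue_measure R).-integrable `[t0, t + 1] (EFin \o mu_of).
  apply: continuous_compact_integrable; first exact: segment_compact.
  apply/subspace_continuousP => s /= st.
  have st0 : t0 <= s by move: st; rewrite in_itv /= => /andP[].
  apply: (@cvg_comp _ _ _ lam (fun s => s `^ q^-1) _ (nbhs (lam s))).
    have /subspace_continuousP : {within `[t0, t + 1], continuous lam}.
      apply: continuous_subspaceW lam_cont => r /=.
      by rewrite !in_itv /= => /andP[-> _].
    exact.
  exact: powR_continuous_gt0 (lam_gt0 st0).
have lc : {for t, continuous lam}.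
  by apply: differentiable_continuous; apply/derivable1_diffP; exact: lamD.
have cm : {for t, continuous mu_of}.
  exact: continuous_comp lc (powR_continuous_gt0 (lam_gt0 (ltW t0t))).
have tt1 : t < t + 1 by rewrite ltrDl.
have [Fd FE] := continuous_FTC1_closed tt1 ci t0t cm.
rewrite mulrC; apply: is_derive_mull; apply: is_derive_addl.
by rewrite -FE derive1E; exact: derivableP.
Qed.

Lemma is_derive_tau t : t0 < t ->
  is_derive t 1 (tau_of t0 q lam) (theta_of t `^ (q - 1) * mu_of t).
Proof.
move=> t0t; rewrite tau_ofE.
apply: is_derive_eq (is_derive_powR q (theta_of_gt0 t) (is_derive_theta t0t)) _.
by field; rewrite gt_eqF.
Qed.

Lemma derive1_tau t : t0 < t ->
  derive1 (tau_of t0 q lam) t = theta_of t `^ (q - 1) * mu_of t.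
Proof. by move=> t0t; rewrite derive1E; have [_ ->] := is_derive_tau t0t. Qed.

Lemma derive1_tau_gt0 t : t0 < t -> 0 < derive1 (tau_of t0 q lam) t.
Proof.
move=> t0t; rewrite derive1_tau //; apply: mulr_gt0; last exact: mu_of_gt0.
exact: powR_gt0 (theta_of_gt0 t).
Qed.

Lemma is_derive_dtau t : t0 < t ->
  is_derive t 1 (derive1 (tau_of t0 q lam)) (derive1n 2 (tau_of t0 q lam) t).
Proof.
move=> t0t; rewrite /= derive1E; apply: derivableP.
apply: (@near_eq_derivable _ _ _ (fun s => theta_of s `^ (q - 1) * mu_of s)).
  near=> s; rewrite derive1_tau //; near: s; exact: lt_nbhsr.
have lD : is_derive t 1 lam ('D_1 lam t) by apply: derivableP; exact: lamD.
apply: ex_derive; apply: is_derive_mul.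
  exact: is_derive_powR (theta_of_gt0 t) (is_derive_theta t0t).
exact: is_derive_powR (lam_gt0 (ltW t0t)) lD.
Unshelve. all: by end_near. Qed.

Lemma tau_div_dtau t : t0 < t ->
  tau_of t0 q lam t / derive1 (tau_of t0 q lam) t = theta_of t / mu_of t.
Proof.
move=> t0t; rewrite derive1_tau // tau_ofE powRB.
  rewrite powRr1 ?(ltW (theta_of_gt0 t)) //; field.
  by rewrite (gt_eqF (mu_of_gt0 t0t)) (gt_eqF (theta_of_gt0 t))
    (gt_eqF (powR_gt0 _ (theta_of_gt0 t))).
by rewrite (gt_eqF (theta_of_gt0 t)) implybT.
Qed.

End Tau.

Section FlowLimits.
Set Implicit Arguments.
Unset Strict Implicit.
Variables (R : realType) (H : completeNormedModType R) (ip : inner_product H).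
Variables (f : H -> R) (gf : H -> H).
Hypothesis fA : assumptionA ip f gf.
Variables (t0 gamma : R) (tau dtau : R -> R) (x y : R -> H).
Hypothesis gamma_gt1 : 1 < gamma.
Hypothesis tau_gt0 : forall t, t0 < t -> 0 < tau t.
Hypothesis dtau_gt0 : forall t, t0 < t -> 0 < dtau t.
Hypothesis tauD : forall t, t0 < t -> is_derive t 1 tau (dtau t).
Hypothesis yD : forall t, t0 < t -> is_derive t 1 y (- dtau t *: gf (y t)).
Hypothesis xD : forall t, t0 < t ->
  is_derive t 1 x ((gamma * (dtau t / tau t)) *: (y t - x t)).
Hypothesis tau_pinfty : tau @ +oo --> +oo.

Lemma averaged_gap_le z (eps : R) : argmin f z -> 0 < eps ->
  \forall t \near +oo,
    f (x t) - f z <= (eps * gamma / (gamma - 1) + eps) * (tau t)^-1.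
Proof.
move=> zS e0.
have gap := flow_gap_cvg0 fA tau_gt0 dtau_gt0 tauD yD tau_pinfty zS.
have : \forall t \near +oo,
    f (x t) - f z <= (eps * gamma / (gamma - 1) + eps) * tau t `^ (- 1).
  apply: (@averaged_le _ t0 tau dtau tau_gt0 dtau_gt0 tauD tau_pinfty
    gamma 1 eps
    (fun t => f (x t) - f z)
    (fun t => ip (gf (x t)) ((gamma * (dtau t / tau t)) *: (y t - x t)))
    (fun t => f (y t) - f z)) => //.
  - move=> t t0t; apply: is_derive_addr.
    exact: is_derive_grad fA _ _ _ (xD t0t).
  - move=> t t0t; rewrite innerZr; apply: ler_wpM2l.
      rewrite mulr_ge0 ?divr_ge0 ?(ltW (tau_gt0 t0t)) ?(ltW (dtau_gt0 t0t)) //.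
      exact: le_trans ler01 (ltW gamma_gt1).
    by have := grad_convex_le fA (x t) (y t); lra.
  - near=> t.
    have t0t : t0 < t by near: t; exact: nbhs_pinfty_gt (num_real _).
    rewrite powR_inv1 ?(ltW (tau_gt0 t0t)) // ler_pdivlMr ?tau_gt0 // mulrC.
    by near: t; exact: (cvgr_le _ gap _ e0).
apply: filter_app; near=> t.
have t0t : t0 < t by near: t; exact: nbhs_pinfty_gt (num_real _).
by rewrite powR_inv1 ?(ltW (tau_gt0 t0t)).
Unshelve. all: by end_near. Qed.

Lemma flow_value_le z (e : R) : argmin f z -> 0 < e ->
  \forall t \near +oo, f (y t) <= f z + e.
Proof.
move=> zS e0.
have gap := flow_gap_cvg0 fA tau_gt0 dtau_gt0 tauD yD tau_pinfty zS.
near=> t.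
have t0t : t0 < t by near: t; exact: nbhs_pinfty_gt (num_real _).
have t1 : 1 <= tau t by near: t; exact: cvgry_ge.
have h : tau t * (f (y t) - f z) <= e.
  by near: t; exact: (cvgr_le _ gap _ e0).
have g0 : 0 <= f (y t) - f z by rewrite subr_ge0; exact: zS.
have := ler_wpM2r g0 t1; lra.
Unshelve. all: by end_near. Qed.

Lemma weak_cluster_argmin z A w : argmin f z ->
  weak_cluster ip y A w -> argmin f w.
Proof.
move=> zS wc u; apply: le_trans (zS u); apply/ler_addgt0Pr => e e0.
have [T [_ hT]] := flow_value_le zS e0.
have : ip w (gf w) <= f z + e - f w + ip w (gf w).
  apply: (wc T) => t _ /hT.
  have := grad_convex_le fA w (y t); rewrite innerBr !(inner_sym ip (gf w)).
  lra.
lra.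
Qed.

Lemma flow_weak_cvg : exists2 z, argmin f z & weak_cvg_pinfty ip y z.
Proof.
have [_ _ _ [z zS] _] := fA.
pose t1 := t0 + 1; have t01 : t0 < t1 by rewrite ltrDl.
pose M := 4 * flow_dist ip y z t1 + 2 * ip z z.
apply: (@opial _ _ ip y (argmin f) _ t1 M); last 2 first.
- move=> t t1t.
  have := flow_dist_nincr fA dtau_gt0 yD zS t01 (ltW t1t).
  have := inner_ge0 ip (y t - z - z).
  rewrite /M; set d := flow_dist ip y z t1.
  rewrite /flow_dist !innerBl !innerBr (inner_sym ip z (y t)); lra.
- by move=> A w; exact: weak_cluster_argmin zS.
- move=> w w' wS w'S.
  have [l lc] := cvg_flow_dist fA dtau_gt0 yD wS.
  have [l' l'c] := cvg_flow_dist fA dtau_gt0 yD w'S.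
  exists (l' - l + 2^-1 * (ip w w - ip w' w')).
  have -> : (fun t => ip (y t) (w - w')) = (fun t =>
      flow_dist ip y w' t - flow_dist ip y w t + 2^-1 * (ip w w - ip w' w')).
    apply/funext => t; rewrite /flow_dist !innerBl !innerBr.
    by rewrite (inner_sym ip w (y t)) (inner_sym ip w' (y t)); field.
  by apply: cvgD; [exact: cvgB|exact: cvg_cst].
Qed.

Lemma averaged_weak_cvg z : weak_cvg_pinfty ip y z -> weak_cvg_pinfty ip x z.
Proof.
move=> yz.
have half h (e : R) : 0 < e -> \forall t \near +oo, ip (x t) h - ip z h <= e.
  move=> e0; have e20 : 0 < e / 2 by rewrite divr_gt0.
  have : \forall t \near +oo, ip (x t) h - ip z h <=
      (e / 2 * gamma / (gamma - 0) + e / 2) * tau t `^ (- 0).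
    apply: (@averaged_le _ t0 tau dtau tau_gt0 dtau_gt0 tauD tau_pinfty
      gamma 0 (e / 2)
      (fun t => ip (x t) h - ip z h)
      (fun t => ip ((gamma * (dtau t / tau t)) *: (y t - x t)) h + ip (x t) 0)
      (fun t => ip (y t) h - ip z h)) => //.
    - exact: lt_trans ltr01 gamma_gt1.
    - move=> t t0t; apply: is_derive_addr.
      exact: is_derive_inner (xD t0t) (is_derive_cst _ _ _).
    - move=> t t0t; rewrite -(subrr h) innerBr subrr addr0 inner_linZ innerBl.
      by rewrite le_eqVlt; apply/orP; left; apply/eqP; ring.
    - near=> t; rewrite oppr0 powRr0 mulr1 lerBlDl; near: t.
      by apply: cvgr_le (yz h) _ _; rewrite ltrDl.
  apply: filter_app; near=> t.
  rewrite oppr0 powRr0 mulr1 addr0 mulfK; first by lra.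
  by rewrite gt_eqF // (lt_trans ltr01).
move=> h; apply/cvgrPdist_le => e e0; near=> t.
rewrite ler_norml; apply/andP; split.
  by rewrite lerNl opprB; near: t; exact: half.
have : ip (x t) (- h) - ip z (- h) <= e by near: t; exact: half.
by rewrite !innerNr opprK addrC.
Unshelve. all: by end_near. Qed.

End FlowLimits.

Section Reduction.
Set Implicit Arguments.
Unset Strict Implicit.
Variables (R : realType) (H : normedModType R).

Lemma is_derive_extrapolation (x dx : R -> H) (tau dtau : R -> R)
    (gamma t ddtau : R) (ddx g : H) :
  gamma != 0 -> tau t != 0 -> dtau t != 0 ->
  is_derive t 1 tau (dtau t) -> is_derive t 1 dtau ddtau ->
  is_derive t 1 x (dx t) -> is_derive t 1 dx ddx ->
  ddx + (((1 + gamma) * dtau t ^+ 2 - tau t * ddtau) / (tau t * dtau t)) *: dx t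
    + (gamma * (dtau t ^+ 2 / tau t)) *: g = 0 ->
  is_derive t 1 (fun s => x s + (gamma^-1 * (tau s / dtau s)) *: dx s)
    (- dtau t *: g).
Proof.
move=> gN0 tN0 dN0 tauD dtauD xD dxD.
set A := (X in _ + X *: dx t + _); set B := (X in _ + X *: g) => ode.
have ddxE : ddx = - A *: dx t + - B *: g.
  by apply/eqP; rewrite !scaleNr -opprD -addr_eq0 addrA; apply/eqP.
have kD : is_derive t 1 (fun s => gamma^-1 * (tau s / dtau s))
    (gamma^-1 * (1 - tau t * ddtau / dtau t ^+ 2)).
  apply: is_derive_eq
    (is_derive_mull gamma^-1 (is_derive_mul tauD (is_deriveV dN0 dtauD))) _.
  by rewrite /GRing.scale /=; field; rewrite dN0 gN0.
apply: is_derive_eq (is_derive_add xD (is_derive_scale kD dxD)) _.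
rewrite ddxE scalerDr !scalerA !addrA -{1}[dx t]scale1r -!scalerDl.
set a := (X in X *: dx t); set b := (X in _ + X *: g).
have -> : a = 0 by rewrite /a /A; field; rewrite gN0 tN0 dN0.
have -> : b = - dtau t by rewrite /b /B; field; rewrite gN0 tN0 dN0.
by rewrite scale0r add0r.
Qed.

End Reduction.

Section ClosedLoop.
Set Implicit Arguments.
Unset Strict Implicit.
Variable R : realType.

Lemma powR_closed_loop (l V p q : R) : 0 < l -> 0 <= V -> 1 < p -> 0 < q ->
  l `^ p * V `^ (p - 1) = 1 ->
  V ^+ 2 = (l `^ q^-1) `^ (- (2 * q * p / (p - 1))).
Proof.
move=> l0 V0 p1 q0 lV.
have p10 : 0 < p - 1 by rewrite subr_gt0.
have VN0 : V `^ (p - 1) != 0.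
  by apply/eqP => V10; move: lV => /eqP; rewrite V10 mulr0 eq_sym oner_eq0.
have lE : l `^ p = V `^ (- (p - 1)).
  by apply: (mulIf VN0); rewrite powRN lV mulVf.
have -> : (l `^ q^-1) `^ (- (2 * q * p / (p - 1))) =
    (l `^ p) `^ (- (2 / (p - 1))).
  by rewrite -!powRrM; congr (_ `^ _); field; rewrite !gt_eqF.
rewrite lE -powRrM mulrNN mulrC divfK ?gt_eqF //.
by rewrite powR_mulrn.
Qed.

End ClosedLoop.

Theorem mainTheorem8 (R : realType) (H : completeNormedModType R)
  (ip : inner_product H) (f : H -> R) (gf : H -> H)
  (t0 q p gamma : R) (x : R -> H) (lam : R -> R) :
  assumptionA ip f gf ->
  0 < t0 -> 0 < q -> 1 <= p -> 1 < gamma ->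
  (* x twice continuously differentiable *)
  (forall t, t0 < t -> derivable x t 1 /\ derivable (derive1 x) t 1) ->
  {in `]t0, +oo[, continuous (derive1n 2 x)} ->
  (* lambda positive, continuously differentiable *)
  (forall t, t0 <= t -> 0 < lam t) ->
  {within `[t0, +oo[, continuous lam} ->
  (forall t, t0 < t -> derivable lam t 1) ->
  {in `]t0, +oo[, continuous (derive1 lam)} ->
  (let tau := tau_of t0 q lam in
   let y := fun t => x t + (gamma^-1 * (tau t / derive1 tau t)) *: derive1 x t in
   forall t, t0 < t ->
     derive1n 2 x t
     + (((1 + gamma) * derive1 tau t ^+ 2 - tau t * derive1n 2 tau t)
          / (tau t * derive1 tau t)) *: derive1 x t
     + (gamma * (derive1 tau t ^+ 2 / tau t)) *: gf (y t) = 0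
   /\ lam t `^ p * `|derive1 tau t| `^ (p - 1) * `|gf (y t)| `^ (p - 1) = 1) ->
  littleo_pinfty (fun t => f (x t) - inf (range f))
                 (fun t => t `^ (- (1 + q - p^-1)))
  /\ exists2 z, z \in argmin f & weak_cvg_pinfty ip x z.
Proof.
move=> fA t0_gt0 q_gt0 p1 gamma1 xdd _ lam_gt0 lam_cont lamD _.
move=> /[let] tau /[let] y ode.
have g0 : 0 < gamma by exact: lt_trans gamma1.
have p0 : 0 < p by exact: lt_le_trans p1.
pose dtau := derive1 tau.
pose theta := theta_of t0 q lam; pose mu := mu_of q lam.
have tauE t : tau t = theta t `^ q by rewrite /tau tau_ofE.
have theta_gt0 t : 0 < theta t by exact: theta_of_gt0.
have mu_gt0 t : t0 < t -> 0 < mu t by exact: mu_of_gt0.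
have thetaD t : t0 < t -> is_derive t 1 theta (mu t / q).
  by move=> t0t; exact: is_derive_theta.
have tau_gt0 t : t0 < t -> 0 < tau t by move=> t0t; rewrite tauE powR_gt0.
have dtau_gt0 t : t0 < t -> 0 < dtau t by move=> t0t; exact: derive1_tau_gt0.
have tauD t : t0 < t -> is_derive t 1 tau (dtau t).
  by move=> t0t; rewrite /dtau derive1_tau //; exact: is_derive_tau.
have yD t : t0 < t -> is_derive t 1 y (- dtau t *: gf (y t)).
  move=> t0t; have [xd dxd] := xdd t t0t.
  have [odet _] := ode t t0t.
  have gN0 : gamma != 0 by rewrite gt_eqF.
  have tN0 : tau t != 0 by rewrite gt_eqF // tau_gt0.
  have dN0 : dtau t != 0 by rewrite gt_eqF // dtau_gt0.
  have dtauD : is_derive t 1 dtau (derive1n 2 tau t) by exact: is_derive_dtau.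
  have x1D : is_derive t 1 x (derive1 x t).
    by rewrite derive1E; exact: derivableP.
  have x2D : is_derive t 1 (derive1 x) (derive1n 2 x t).
    by rewrite /= [X in is_derive _ _ _ X]derive1E; exact: derivableP.
  exact: is_derive_extrapolation gN0 tN0 dN0 (tauD t t0t) dtauD x1D x2D odet.
have xD t : t0 < t ->
    is_derive t 1 x ((gamma * (dtau t / tau t)) *: (y t - x t)).
  move=> t0t; have [xd _] := xdd t t0t.
  apply: is_derive_eq (derivableP xd) _.
  rewrite -derive1E /y [x t + _]addrC addrK scalerA.
  have -> : gamma * (dtau t / tau t) * (gamma^-1 * (tau t / dtau t)) = 1.
    by field; rewrite !gt_eqF ?tau_gt0 ?dtau_gt0.
  by rewrite scale1r.
have [_ _ _ [xs xsmin] _] := fA.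
pose alpha := 1 + q - p^-1.
have alpha0 : 0 < alpha.
  by rewrite /alpha addrAC ltr_wpDl // subr_ge0 invf_le1.
have [c0 c00 growth] : exists2 c : R, 0 < c &
    \forall t \near +oo, c * t `^ (alpha / q) <= theta t.
  have [p_gt1|] := ltrP 1 p; last first.
    move=> p_le1; have pE : p = 1 by apply/eqP; rewrite eq_le p_le1 p1.
    have mu1 t : t0 < t -> mu t = 1.
      move=> t0t; have [_] := ode t t0t.
      rewrite pE subrr !powRr0 !mulr1 powRr1 ?(ltW (lam_gt0 _ (ltW t0t))) //.
      by rewrite /mu /mu_of => ->; rewrite powR1.
    have [c c0 hc] := theta_growth1 q_gt0 (fun t _ => theta_gt0 t) thetaD mu1.
    exists c => //; near=> t.
    have -> : alpha / q = 1.
      by rewrite /alpha pE invr1 addrAC subrr add0r divff // gt_eqF.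
    by rewrite powRr1; near: t => //; exact: nbhs_pinfty_ge (num_real _).
  pose m := 1 + 2 * q * p / (p - 1).
  have pN1 : 0 < p - 1 by rewrite subr_gt0.
  have m1 : 1 < m by rewrite ltrDl divr_gt0 ?mulr_gt0.
  have -> : alpha / q = (m + 1) / (m - 1).
    rewrite /alpha /m; field.
    have -> : p - 1 + 2 * q * p + -1 * (p - 1) = 2 * q * p by ring.
    by rewrite !gt_eqF ?mulr_gt0.
  apply: (@theta_growth _ t0 q theta mu t0_gt0 q_gt0 (fun t _ => theta_gt0 t)
    mu_gt0 thetaD m (flow_energy ip f tau y xs) _ m1).
  - by move=> t t0t; apply: (flow_energy_ge0 ip y tau_gt0).
  - by move=> t t0t; exact: (is_derive_flow_energy fA tauD yD xs t0t).
  move=> t t0t.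
  apply: le_trans (flow_energy_derive_le fA tau y dtau_gt0 xsmin t0t) _.
  rewrite lerN2 le_eqVlt; apply/orP; left; apply/eqP.
  have [_ loop] := ode t t0t.
  have V0 : 0 <= dtau t * `|gf (y t)| by rewrite mulr_ge0 // ltW // dtau_gt0.
  have := @powR_closed_loop _ (lam t) (dtau t * `|gf (y t)|) p q
    (lam_gt0 _ (ltW t0t)) V0 p_gt1 q_gt0.
  rewrite powRM ?(ltW (dtau_gt0 _ t0t)) // mulrA.
  move: loop; rewrite ger0_norm ?(ltW (dtau_gt0 _ t0t)) // => loop /(_ loop).
  rewrite -[lam t `^ q^-1]/(mu t) => VE.
  have -> : mu t `^ (- m) = (mu t)^-1 * mu t `^ (- (2 * q * p / (p - 1))).
    rewrite /m opprD powRD; last by rewrite (gt_eqF (mu_gt0 _ t0t)) implybT.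
    by rewrite powR_inv1 ?(ltW (mu_gt0 _ t0t)).
  have TD : tau t / dtau t = theta t / mu t by exact: tau_div_dtau.
  rewrite mulrA -TD -VE.
  by field; rewrite gt_eqF // dtau_gt0.
have tau_growth : exists2 c : R, 0 < c &
    \forall t \near +oo, c * t `^ alpha <= tau t.
  exists (c0 `^ q); first exact: powR_gt0.
  near=> t; rewrite tauE.
  have -> : c0 `^ q * t `^ alpha = (c0 * t `^ (alpha / q)) `^ q.
    by rewrite powRM ?powR_ge0 ?(ltW c00) // -powRrM divfK // gt_eqF.
  have tle : c0 * t `^ (alpha / q) <= theta t by near: t.
  apply: ge0_ler_powR tle; rewrite ?nnegrE ?(ltW q_gt0) ?(ltW (theta_gt0 t)) //.
  by rewrite mulr_ge0 ?powR_ge0 ?(ltW c00).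
have [c c_gt0 tau_ge] := tau_growth.
have tau_pinfty : tau @ +oo --> +oo.
  apply/cvgryPge => A; near=> t.
  have tle : c * t `^ alpha <= tau t by near: t.
  apply: le_trans tle; rewrite mulrC -ler_pdivrMr //; near: t.
  exact: (@near_le_powR _ id (@cvg_id _ _)).
split.
  have -> : inf (range f) = f xs.
    apply/eqP; rewrite eq_le; apply/andP; split.
      by apply: ge_inf; [exists (f xs) => _ [u _ <-]; exact: xsmin|exists xs].
    by apply: lb_le_inf => [|_ [u _ <-]]; [exists (f xs), xs|exact: xsmin].
  move=> eps eps0; pose D := gamma / (gamma - 1) + 1.
  have D0 : 0 < D by rewrite addr_gt0 // divr_gt0 // subr_gt0.
  have e0 : 0 < eps * c / D by rewrite divr_gt0 // mulr_gt0.
  have gap := averaged_gap_le fA gamma1 tau_gt0 dtau_gt0 tauD yD xD tau_pinfty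
    xsmin e0.
  near=> t.
  have t_gt0 : 0 < t by near: t; exact: nbhs_pinfty_gt (num_real _).
  have tle : c * t `^ alpha <= tau t by near: t.
  have ta0 : 0 < t `^ alpha by exact: powR_gt0.
  rewrite ger0_norm ?subr_ge0 // ger0_norm ?powR_ge0 // -/alpha powRN.
  have gapx : f (x t) - f xs <=
      (eps * c / D * gamma / (gamma - 1) + eps * c / D) * (tau t)^-1.
    by near: t; exact: gap.
  apply: (le_trans gapx).
  have -> : eps * c / D * gamma / (gamma - 1) + eps * c / D = eps * c.
    have -> : eps * c / D * gamma / (gamma - 1) + eps * c / D = eps * c / D * D.
      by rewrite [in RHS]/D; ring.
    by rewrite divfK // gt_eqF.
  have tau_t_gt0 : 0 < tau t by apply: lt_le_trans tle; exact: mulr_gt0.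
  rewrite -mulrA ler_pM2l // ler_pdivrMr // mulrC ler_pdivlMr //.
have [z zS yz] := flow_weak_cvg fA tau_gt0 dtau_gt0 tauD yD tau_pinfty.
exists z; first by rewrite inE.
by have := averaged_weak_cvg gamma1 tau_gt0 dtau_gt0 tauD xD tau_pinfty yz.
Unshelve. all: by end_near. Qed.
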